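(* Let $R$ be a commutative ring in which $2$ is a unit, and let $I$ be a nonzero sdf-absorbing ideal of $R$. Then $I$ is a prime ideal of $R$.
   Context: All rings are commutative with identity $1 \neq 0$. A proper ideal $I$ of a commutative ring $R$ is a square-difference factor absorbing ideal (sdf-absorbing ideal) of $R$ if whenever $a, b \in R$ are both nonzero and $a^2 - b^2 \in I$, then $a + b \in I$ or $a - b \in I$. *)

(* Defs.v *)
From mathcomp Require Import all_boot all_algebra.
From mathcomp Require Import classical_sets.

Set Implicit Arguments.
Unset Strict Implicit.
Unset Printing Implicit Defensive.

Import GRing.Theory.

Local Open Scope ring_scope.

(* [idealr_closed] already includes properness (1 is not in the set). It is
   stated for boolean predicates; [[in I]] is the classical membership predicate
   of an arbitrary subset I, so no decidability of I is assumed. *)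
Definition is_proper_ideal (R : comNzRingType) (I : set R) : Prop :=
  idealr_closed [in I].

Definition is_prime_ideal (R : comNzRingType) (I : set R) : Prop :=
  is_proper_ideal I /\ prime_idealr_closed [in I].

Definition sdf_absorbing (R : comNzRingType) (I : set R) : Prop :=
  is_proper_ideal I /\
  forall a b : R, a != 0 -> b != 0 ->
    a ^+ 2 - b ^+ 2 \in I -> a + b \in I \/ a - b \in I.

(* Main.v *)
Require Import Defs.
From mathcomp Require Import all_boot all_algebra.
From mathcomp Require Import boolp classical_sets.
From mathcomp Require Import ring.

(** The identity [((x + y) / 2) ^+ 2 - ((x - y) / 2) ^+ 2 = x * y] turns a
    product in [I] into a difference of two squares, whose factors are again
    [x] and [y]; so the sdf-absorbing condition is the prime condition, except
    when one of the two squared elements vanishes.  That happens only for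
    [y = x] or [y = - x], where [x ^+ 2] lies in [I], and then [x] does too
    because a nonzero sdf-absorbing ideal is radical
    ([sdf_absorbing_sqr_closed]). *)

Local Open Scope classical_set_scope.
Local Open Scope ring_scope.

Import GRing.Theory.

Section ProperIdeal.

Context {R : comNzRingType} {I : set R}.
Context (idealI : is_proper_ideal I).

Lemma ideal0 : 0 \in I.
Proof. by case: idealI. Qed.

Lemma idealMl a u : u \in I -> a * u \in I.
Proof.
by case: idealI => I0 _ IMD uI; rewrite -[a * u]addr0; apply: IMD.
Qed.

Lemma idealD u v : u \in I -> v \in I -> u + v \in I.
Proof.
by case: idealI => _ _ IMD uI vI; rewrite -[u]mul1r; apply: IMD.
Qed.

Lemma idealN u : u \in I -> - u \in I.
Proof. by move=> uI; rewrite -mulN1r; apply: idealMl. Qed.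

Lemma nonzero_ideal_witness : I <> [set 0] -> exists2 i, i \in I & i != 0.
Proof.
move=> nonzeroI; apply: contrapT => noi; apply: nonzeroI.
apply/seteqP; split=> [i Ii | _ ->] /=; last by move: ideal0; rewrite inE.
apply/eqP; apply: contrapT => /negP i_neq0.
by apply: noi; exists i; rewrite ?inE.
Qed.

End ProperIdeal.

(** For a nonzero [i] of [I], the condition applies to
    [x ^+ 2 - i ^+ 2], and both [x + i] and [x - i] are congruent to [x]
    modulo [I].  The zero ideal can fail this: [0] in [Z/4Z] is
    sdf-absorbing, and contains the square of [2]. *)
Lemma sdf_absorbing_sqr_closed (R : comNzRingType) (I : set R) (x : R) :
  I <> [set 0] -> sdf_absorbing I -> x ^+ 2 \in I -> x \in I.
Proof.
move=> nonzeroI [idealI sdfI] x2I.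
have [i iI i_neq0] := nonzero_ideal_witness idealI nonzeroI.
have [-> | x_neq0] := eqVneq x 0; first exact: ideal0.
have x2i2I : x ^+ 2 - i ^+ 2 \in I.
  apply: (idealD idealI) => //; apply: (idealN idealI).
  by rewrite expr2; apply: idealMl.
have [xiI | xiI] := sdfI _ _ x_neq0 i_neq0 x2i2I.
- by rewrite -(addrK i x); apply: (idealD idealI) => //; apply: idealN.
- by rewrite -(subrK i x); apply: idealD.
Qed.

Theorem theorem2p6 (R : comNzRingType) (I : set R)
    (unit2 : exists u : R, 2%:R * u = 1)
    (nonzeroI : I <> [set 0])
    (sdfI : sdf_absorbing I) :
  is_prime_ideal I.
Proof.
have [idealI sdf] := sdfI; split=> // x y xyI; apply/orP.
have [u u2] := unit2.
have [xDy0 | xDy_neq0] := eqVneq (x + y) 0.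
  left; apply: sdf_absorbing_sqr_closed => //.
  have -> : x ^+ 2 = - (x * y) by rewrite -mulrN -(addr0_eq xDy0) opprK expr2.
  exact: idealN.
have [xBy0 | xBy_neq0] := eqVneq (x - y) 0.
  left; apply: sdf_absorbing_sqr_closed => //.
  by rewrite expr2 {2}(subr0_eq xBy0).
have half_neq0 z : z != 0 -> u * z != 0.
  apply: contra_neq => uz0.
  by rewrite -[z]mul1r -u2 -mulrA uz0 mulr0.
have sumE : u * (x + y) + u * (x - y) = x.
  by rewrite -[RHS]mul1r -u2; ring.
have diffE : u * (x + y) - u * (x - y) = y.
  by rewrite -[RHS]mul1r -u2; ring.
have := sdf _ _ (half_neq0 _ xDy_neq0) (half_neq0 _ xBy_neq0).
by rewrite subr_sqr sumE diffE mulrC; apply.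
Qed.
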